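(* Let $\Phi$ be a second-order sentence in the signature $\tau$. Then there is an open $\mathrm{FOT}(\to)$-formula $\Phi^\circ(\bar r)$ such that, for every model $M$ (a $\tau$-structure), $$M\models\Phi\quad\Longleftrightarrow\quad M,M^{\bar r}\models\Phi^\circ(\bar r),$$ where $M^{\bar r}$ denotes the full team over $\bar r$.
   Context: Second-order logic is taken with full (standard) semantics. Structures $M$ have nonempty domain; the same letter denotes a structure and its domain. An assignment over $M$ is a map from a finite set of variables to $M$. A team over $M$ is a set of assignments with a common domain; the empty team is allowed. $s(a/x)$ is the assignment mapping $x$ to $a$ and otherwise agreeing with $s$; $X(a/x)=\{s(a/x):s\in X\}$. For a tuple $\bar r$ of distinct variables, the full team over $\bar r$ is $M^{\bar r}=\{s: s \text{ is a map } \{\bar r\}\to M\}$. Formulas of $\mathrm{FOT}(\to)$: $\varphi::=\lambda\mid\bar x\neq\bar y\mid\dot\sim\varphi\mid(\varphi\land\varphi)\mid(\varphi\vee_w\varphi)\mid\exists^1x\,\varphi\mid\forall^1x\,\varphi\mid(\varphi\to\varphi)$, where $\lambda$ is a first-order atomic formula (including equality) and $\bar x,\bar y$ are tuples of variables of equal length. Satisfaction $M,X\models\varphi$ (the domain of $X$ contains the free variables of $\varphi$): - $M,X\models\lambda$ iff every $s\in X$ satisfies $\lambda$ in $M$ in the usual first-order sense; - $M,X\models\bar x\neq\bar y$ iff $s(\bar x)\neq s(\bar y)$ for all $s\in X$; - $M,X\models\dot\sim\varphi$ iff $X=\emptyset$ or $M,X\not\models\varphi$; - $M,X\models\varphi\land\psi$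 iff $M,X\models\varphi$ and $M,X\models\psi$; - $M,X\models\varphi\vee_w\psi$ iff $M,X\models\varphi$ or $M,X\models\psi$; - $M,X\models\exists^1x\,\varphi$ iff $M,X(a/x)\models\varphi$ for some $a\in M$; - $M,X\models\forall^1x\,\varphi$ iff $M,X(a/x)\models\varphi$ for all $a\in M$; - $M,X\models\varphi\to\psi$ iff for every $Y\subseteq X$, if $M,Y\models\varphi$ then $M,Y\models\psi$. *)

(* Defs.v *)
From mathcomp Require Import all_boot.
From mathcomp Require Import finmap.
From mathcomp Require Import boolp classical_sets.

Set Implicit Arguments.
Unset Strict Implicit.
Unset Printing Implicit Defensive.

(** * Signatures, structures, terms and atomic formulas *)

(** Constants are function symbols of arity 0; there is no restriction on the
    number of symbols. *)
Record signature := Signature {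
  rel_sym : Type;
  rel_ar : rel_sym -> nat;
  fun_sym : Type;
  fun_ar : fun_sym -> nat }.

(** [k]-tuples over [M] are maps ['I_k -> M]. *)
Definition nrel (M : Type) (k : nat) := ('I_k -> M) -> Prop.
Definition nfun (M : Type) (k : nat) := ('I_k -> M) -> M.

Record structure (tau : signature) := Structure {
  dom :> Type;
  dom_inhabited : inhabited dom;
  rel_int : forall R : rel_sym tau, nrel dom (rel_ar R);
  fun_int : forall f : fun_sym tau, nfun dom (fun_ar f) }.

Definition var := nat.

Definition assignment (M : Type) := {fmap var -> M}.

Inductive term (tau : signature) : Type :=
| Var (x : var)
| App (f : fun_sym tau) (ts : 'I_(fun_ar f) -> term tau).
Arguments Var {tau} x.

Inductive atom (tau : signature) : Type :=
| Rel (R : rel_sym tau) (ts : 'I_(rel_ar R) -> term tau)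
| Eq (t u : term tau).

Fixpoint term_vars tau (t : term tau) : {fset var} :=
  match t with
  | Var x => [fset x]
  | App f ts => \bigcup_(i in 'I_(fun_ar f)) term_vars (ts i)
  end%fset.

Definition atom_vars tau (l : atom tau) : {fset var} :=
  match l with
  | Rel R ts => \bigcup_(i in 'I_(rel_ar R)) term_vars (ts i)
  | Eq t u => term_vars t `|` term_vars u
  end%fset.

(** [term_val M s t a]: the value of [t] in [M] under [s] is defined and equal
    to [a].  It is a relation because assignments are finite maps; the value
    exists, and is unique, as soon as [s] is defined on the variables of [t]. *)
Fixpoint term_val tau (M : structure tau) (s : assignment M) (t : term tau)
    (a : M) : Prop :=
  match t with
  | Var x => s.[? x]%fmap = Some a
  | App f ts =>
      exists v : 'I_(fun_ar f) -> M,
        (forall i, term_val s (ts i) (v i)) /\ fun_int v = a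
  end.

Definition atom_sat tau (M : structure tau) (s : assignment M)
    (l : atom tau) : Prop :=
  match l with
  | Rel R ts =>
      exists v : 'I_(rel_ar R) -> M,
        (forall i, term_val s (ts i) (v i)) /\ rel_int v
  | Eq t u => exists a : M, term_val s t a /\ term_val s u a
  end.

(** * Second-order logic with full semantics *)

(** A relation (resp. function) variable is a pair (arity, index). *)
Definition sovar := (nat * nat)%type.

(** The second-order variables are added to [tau] as further symbols, so that
    the atomic second-order formulas over [tau] are the first-order atomic
    formulas over [so_sig tau]; [inl] is for symbols of [tau], [inr] for
    second-order variables. *)
Definition so_sig (tau : signature) : signature := {|
  rel_sym := rel_sym tau + sovar;
  rel_ar := fun R => match R with inl R => rel_ar R | inr X => X.1 end;
  fun_sym := fun_sym tau + sovar;
  fun_ar := fun f => match f with inl f => fun_ar f | inr F => F.1 end |}.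

Definition rel_valuation (M : Type) := forall X : sovar, nrel M X.1.
Definition fun_valuation (M : Type) := forall F : sovar, nfun M F.1.

Definition so_expand tau (M : structure tau) (VR : rel_valuation M)
    (VF : fun_valuation M) : structure (so_sig tau) :=
  @Structure (so_sig tau) M (dom_inhabited M)
    (fun R => match R with inl R => @rel_int tau M R | inr X => VR X end)
    (fun f => match f with inl f => @fun_int tau M f | inr F => VF F end).

Inductive so (tau : signature) : Type :=
| SAtom (l : atom (so_sig tau))
| SNot (phi : so tau)
| SAnd (phi psi : so tau)
| SOr (phi psi : so tau)
| SEx (x : var) (phi : so tau)
| SAll (x : var) (phi : so tau)
| SExR (X : sovar) (phi : so tau)
| SAllR (X : sovar) (phi : so tau)
| SExF (F : sovar) (phi : so tau)
| SAllF (F : sovar) (phi : so tau).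

Fixpoint so_sat tau (M : structure tau) (VR : rel_valuation M)
    (VF : fun_valuation M) (s : assignment M) (phi : so tau) : Prop :=
  match phi with
  | SAtom l => @atom_sat (so_sig tau) (so_expand VR VF) s l
  | SNot phi => ~ so_sat VR VF s phi
  | SAnd phi psi => so_sat VR VF s phi /\ so_sat VR VF s psi
  | SOr phi psi => so_sat VR VF s phi \/ so_sat VR VF s psi
  | SEx x phi => exists a : M, so_sat VR VF s.[x <- a]%fmap phi
  | SAll x phi => forall a : M, so_sat VR VF s.[x <- a]%fmap phi
  | SExR X phi =>
      exists R : nrel M X.1, so_sat (@dfwith _ _ VR X R) VF s phi
  | SAllR X phi =>
      forall R : nrel M X.1, so_sat (@dfwith _ _ VR X R) VF s phi
  | SExF F phi =>
      exists f : nfun M F.1, so_sat VR (@dfwith _ _ VF F f) s phi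
  | SAllF F phi =>
      forall f : nfun M F.1, so_sat VR (@dfwith _ _ VF F f) s phi
  end.

Fixpoint term_fun_vars tau (t : term (so_sig tau)) : {fset sovar} :=
  match t with
  | Var _ => fset0
  | App f ts =>
      (if f is inr F then [fset F] else fset0)
        `|` \bigcup_(i in 'I_(fun_ar f)) term_fun_vars (ts i)
  end%fset.

Definition atom_fun_vars tau (l : atom (so_sig tau)) : {fset sovar} :=
  match l with
  | Rel R ts => \bigcup_(i in 'I_(rel_ar R)) term_fun_vars (ts i)
  | Eq t u => term_fun_vars t `|` term_fun_vars u
  end%fset.

Definition atom_rel_vars tau (l : atom (so_sig tau)) : {fset sovar} :=
  match l with
  | Rel (inr X) _ => [fset X]
  | _ => fset0
  end%fset.

(** Free individual, relation and function variables. *)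
Fixpoint so_fv tau (phi : so tau) : {fset var} :=
  match phi with
  | SAtom l => atom_vars l
  | SAnd phi psi | SOr phi psi => so_fv phi `|` so_fv psi
  | SEx x phi | SAll x phi => so_fv phi `\ x
  | SNot phi | SExR _ phi | SAllR _ phi | SExF _ phi | SAllF _ phi => so_fv phi
  end%fset.

Fixpoint so_fv_rel tau (phi : so tau) : {fset sovar} :=
  match phi with
  | SAtom l => atom_rel_vars l
  | SAnd phi psi | SOr phi psi => so_fv_rel phi `|` so_fv_rel psi
  | SExR X phi | SAllR X phi => so_fv_rel phi `\ X
  | SNot phi | SEx _ phi | SAll _ phi | SExF _ phi | SAllF _ phi =>
      so_fv_rel phi
  end%fset.

Fixpoint so_fv_fun tau (phi : so tau) : {fset sovar} :=
  match phi with
  | SAtom l => atom_fun_vars l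
  | SAnd phi psi | SOr phi psi => so_fv_fun phi `|` so_fv_fun psi
  | SExF F phi | SAllF F phi => so_fv_fun phi `\ F
  | SNot phi | SEx _ phi | SAll _ phi | SExR _ phi | SAllR _ phi =>
      so_fv_fun phi
  end%fset.

Definition so_sentence tau (phi : so tau) : Prop :=
  [/\ so_fv phi = fset0, so_fv_rel phi = fset0 & so_fv_fun phi = fset0]%fset.

(** Used for sentences only, whose satisfaction does not depend on the
    valuations; valuations exist because structures are nonempty. *)
Definition so_models tau (M : structure tau) (phi : so tau) : Prop :=
  forall (VR : rel_valuation M) (VF : fun_valuation M),
    so_sat VR VF [fmap]%fmap phi.

(** * Teams and FOT(->) *)

(** Satisfaction is defined on arbitrary sets of assignments.  Only teams, that
    is, sets of assignments with a common domain, matter: the clauses below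
    evaluate subformulas of a formula only on teams once the initial set of
    assignments is one, such as [full_team]. *)
Definition is_team M (X : set (assignment M)) : Prop :=
  exists D : {fset var}, forall s : assignment M, X s -> domf s = D.

Definition team_subst M (X : set (assignment M)) (a : M) (x : var) :
    set (assignment M) :=
  [set s.[x <- a]%fmap | s in X]%classic.

Definition full_team (M : Type) (r : seq var) : set (assignment M) :=
  [set s : assignment M | domf s = [fset x in r]%fset]%classic.

Lemma is_team_full M r : is_team (@full_team M r).
Proof. by exists [fset x in r]%fset. Qed.

Lemma is_team_sub M (X Y : set (assignment M)) :
  (Y `<=` X)%classic -> is_team X -> is_team Y.
Proof. by move=> YX [D XD]; exists D => s /YX /XD. Qed.

Lemma is_team_subst M (X : set (assignment M)) a x :
  is_team X -> is_team (team_subst X a x).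
Proof.
by move=> [D XD]; exists (x |` D)%fset => _ [s /XD <- <-]; rewrite dom_setf.
Qed.

Inductive fot (tau : signature) : Type :=
| FAtom (l : atom tau)
| FNeq (k : nat) (xs ys : k.-tuple var)
| FNot (phi : fot tau)
| FAnd (phi psi : fot tau)
| FOr (phi psi : fot tau)
| FEx (x : var) (phi : fot tau)
| FAll (x : var) (phi : fot tau)
| FImp (phi psi : fot tau).

Fixpoint fot_fv tau (phi : fot tau) : {fset var} :=
  match phi with
  | FAtom l => atom_vars l
  | FNeq _ xs ys => [fset x in tval xs] `|` [fset y in tval ys]
  | FNot phi => fot_fv phi
  | FAnd phi psi | FOr phi psi | FImp phi psi => fot_fv phi `|` fot_fv psi
  | FEx x phi | FAll x phi => fot_fv phi `\ x
  end%fset.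

Fixpoint fot_sat tau (M : structure tau) (X : set (assignment M))
    (phi : fot tau) : Prop :=
  match phi with
  | FAtom l => forall s, X s -> atom_sat s l
  | FNeq _ xs ys =>
      forall s, X s -> [seq s.[? x] | x <- xs]%fmap <> [seq s.[? y] | y <- ys]%fmap
  | FNot phi => X = set0 \/ ~ fot_sat X phi
  | FAnd phi psi => fot_sat X phi /\ fot_sat X psi
  | FOr phi psi => fot_sat X phi \/ fot_sat X psi
  | FEx x phi => exists a : M, fot_sat (team_subst X a x) phi
  | FAll x phi => forall a : M, fot_sat (team_subst X a x) phi
  | FImp phi psi =>
      forall Y : set (assignment M),
        (Y `<=` X)%classic -> fot_sat Y phi -> fot_sat Y psi
  end.

(* Main.v *)
Require Import Defs.
From mathcomp Require Import all_boot.
From mathcomp Require Import finmap.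
From mathcomp Require Import boolp classical_sets.

(** The team quantified by the implication is used to store functions.  Its
    variables are [K] shared arguments and one value column for each nested
    second-order quantifier; after [d] quantifiers, the current team consists of
    all assignments whose first [d] values are [f_0], ..., [f_(d-1)] applied to
    the arguments.  A subteam of it in which every combination of arguments and
    later values still occurs and in which value [d] is determined by the
    arguments amounts to the choice of a function [f_d]: the earlier functions
    cannot change, since their arguments are still unrestricted.  Hence
    second-order quantification becomes [theta -> phi], with [theta] expressing
    these two conditions; the dotted negation of [x <> r] says that the tuple of
    constants [x] occurs in the team.  Relations are coded by functions, which is possible as
    soon as there are two elements; over a one-element structure, where no
    proper nonempty subteam exists, relations are replaced by truth values. *)

Set Implicit Arguments.
Unset Strict Implicit.
Unset Printing Implicit Defensive.

(** * Teams with varying columns and constant variables *)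

Section Teams.
Local Open Scope classical_set_scope.
Variables (tau : signature) (M : structure tau) (w : nat).
Implicit Types (P Q : set (nat -> M)) (c g : nat -> M) (n : nat).

(** Total maps stand for assignments, so that members of a team can be evaluated without partiality;
    the domain is exactly the set of variables below [n]. *)
Fixpoint initial_assignment n g : assignment M :=
  if n is m.+1 then (initial_assignment m g).[m <- g m]%fmap else [fmap]%fmap.

Lemma initial_assignmentE n g i :
  (initial_assignment n g).[? i]%fmap = if i < n then Some (g i) else None.
Proof.
elim: n => [|n IHn] /=; first by rewrite fnd_fmap0.
rewrite fnd_set IHn ltnS; case: eqVneq => [->|ni]; first by rewrite leqnn.
by rewrite ltn_neqAle ni.
Qed.

Lemma eq_initial_assignment n g g' :
  (forall i, i < n -> g i = g' i) -> initial_assignment n g = initial_assignment n g'.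
Proof.
move=> gg'; apply/fmapP => i; rewrite !initial_assignmentE.
by case: ifP => // /gg' ->.
Qed.

Definition glue c g : nat -> M := fun i => if i < w then g i else c i.

(** The variables below [w] are the columns of the team and the variables from
    [w] to [n - 1] are constant, with values given by [c]. *)
Definition team_of P n c : set (assignment M) :=
  [set initial_assignment n (glue c g) | g in P]%classic.

Definition holds P n c (phi : fot tau) := fot_sat (team_of P n c) phi.

Lemma team_of_fnd P n c s i : team_of P n c s -> w <= i < n ->
  s.[? i]%fmap = Some (c i).
Proof.
move=> [g _ <-] /andP[wi i_n].
by rewrite initial_assignmentE i_n /glue ltnNge wi.
Qed.

Lemma team_of_eq0 P n c : team_of P n c = set0 <-> P = set0.
Proof.
rewrite /team_of; split=> [|->]; last by rewrite image_set0.
by move/image_set0_set0.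
Qed.

Lemma eq_team_of P n c c' : (forall i, w <= i < n -> c i = c' i) ->
  team_of P n c = team_of P n c'.
Proof.
move=> cc'; apply: eq_imagel => g _; apply: eq_initial_assignment => i i_n.
by rewrite /glue; case: ltnP => // wi; rewrite cc' // wi.
Qed.

(** Values of [g] from [w] on are overwritten by [c], so inclusions of teams need only be checked on
    the columns. *)
Lemma team_of_cols P Q n c :
  (forall g, Q g -> exists2 g', P g' & forall i, i < w -> g i = g' i) ->
  (team_of Q n c `<=` team_of P n c)%classic.
Proof.
move=> QP _ [g /QP[g' Pg' gg'] <-]; exists g' => //.
apply: eq_initial_assignment => i _; rewrite /glue.
by case: ltnP => // /gg' ->.
Qed.

(** Since [n] is not a column, a quantifier over it merely records one more constant; the former
    value of [c] at [n] lies outside the domain. *)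
Lemma team_substE P n c a : w <= n ->
  team_subst (team_of P n c) a n = team_of P n.+1 [eta c with n |-> a].
Proof.
move=> wn; have E g : (initial_assignment n (glue c g)).[n <- a]%fmap =
    initial_assignment n.+1 (glue [eta c with n |-> a] g).
  rewrite /= /glue ltnNge wn /= eqxx; congr (_.[_ <- _])%fmap.
  apply: eq_initial_assignment => i i_n; case: ifP => //= _.
  by rewrite ltn_eqF.
apply/seteqP; split=> s.
  by move=> [_ [g Pg <-] <-]; exists g; rewrite ?E.
by move=> [g Pg <-]; exists (initial_assignment n (glue c g)); [exists g|rewrite E].
Qed.

Lemma holds_ex P n c phi : w <= n ->
  holds P n c (FEx n phi) <-> exists a, holds P n.+1 [eta c with n |-> a] phi.
Proof.
by move=> wn; split=> -[a]; rewrite ?team_substE // => H; exists a;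
  rewrite ?team_substE.
Qed.

Lemma holds_all P n c phi : w <= n ->
  holds P n c (FAll n phi) <-> forall a, holds P n.+1 [eta c with n |-> a] phi.
Proof.
by move=> wn; split=> H a; [rewrite /holds -team_substE //; apply: H|
  rewrite team_substE //; apply: H].
Qed.

Lemma holds_not P n c phi : P !=set0 -> holds P n c (FNot phi) <-> ~ holds P n c phi.
Proof.
move=> P0; split=> [[/team_of_eq0 PE|//]|?]; last by right.
by move: P0; rewrite PE => -[].
Qed.

Lemma holds_imp P n c phi psi : holds P n c (FImp phi psi) <->
  forall Q, (Q `<=` P)%classic -> holds Q n c phi -> holds Q n c psi.
Proof.
split=> [H Q QP|H Y YP].
  by apply: H => s [g /QP Pg <-]; exists g.
(* Every subteam comes from a subset of [P], namely from the maps whose assignment lies in [Y]. *)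
have -> : Y = team_of (fun g => P g /\ Y (initial_assignment n (glue c g))) n c.
  apply/seteqP; split=> s; last by move=> [g [_ ?] <-].
  by move=> Ys; have [g Pg sE] := YP s Ys; exists g; rewrite ?sE.
by apply: H => g [].
Qed.

(** Zipping yields two sequences whose lengths agree by construction, as the typing of [FNeq]
    demands; sequences of equal length lose nothing. *)
Definition neq_seq (xs ys : seq var) : fot tau :=
  FNeq tau (map_tuple fst (in_tuple (zip xs ys))) (map_tuple snd (in_tuple (zip xs ys))).

Definition occurs xs ys := FNot (neq_seq xs ys).

Lemma holds_neq_seq P n c xs ys : w <= n -> size xs = size ys ->
  (forall x, x \in xs -> x < w) -> (forall y, y \in ys -> w <= y < n) ->
  holds P n c (neq_seq xs ys) <-> forall g, P g -> map g xs <> map c ys.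
Proof.
move=> wn sz xsw ysw.
have E g : P g -> [seq (initial_assignment n (glue c g)).[? x]%fmap | x <- xs] =
                    map Some (map g xs).
  move=> _; rewrite -map_comp; apply/eq_in_map => x /xsw xw /=.
  by rewrite initial_assignmentE (leq_trans xw) // /glue xw.
have E' s : team_of P n c s -> [seq s.[? y]%fmap | y <- ys] = map Some (map c ys).
  move=> Ps; rewrite -map_comp; apply/eq_in_map => y /ysw.
  exact: (team_of_fnd Ps).
have injS : injective (map (@Some M)) by apply: inj_map => ? ? [].
rewrite /holds /= -/(unzip1 _) -/(unzip2 _) unzip1_zip ?unzip2_zip ?sz //.
split=> H.
  move=> g Pg gc; have Ps : team_of P n c (initial_assignment n (glue c g)) by exists g.
  by apply: (H _ Ps); rewrite E // E' // gc.
move=> _ [g Pg <-]; have Ps : team_of P n c (initial_assignment n (glue c g)) by exists g.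
by rewrite E // E' // => /injS; apply: H.
Qed.

Lemma holds_occurs P n c xs ys : P !=set0 -> w <= n -> size xs = size ys ->
  (forall x, x \in xs -> x < w) -> (forall y, y \in ys -> w <= y < n) ->
  holds P n c (occurs xs ys) <-> exists2 g, P g & map g xs = map c ys.
Proof.
move=> P0 wn sz xsw ysw; rewrite holds_not // holds_neq_seq //; split.
  by move/existsNP => [g /not_implyP[Pg /contrapT ?]]; exists g.
by move=> [g Pg gE] H; exact: H gE.
Qed.

(** Both variables are constant on the team, so all members impose the same equation; some member
    must exist for the atom to impose it at all. *)
Lemma holds_eq_var P n c x y : P !=set0 -> w <= x < n -> w <= y < n ->
  holds P n c (FAtom (Eq (Var x) (Var y))) <-> c x = c y.
Proof.
move=> [g Pg] xn yn; split=> [H|cxy s Ps].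
  have Ps : team_of P n c (initial_assignment n (glue c g)) by exists g.
  have [a /=[]] := H _ Ps.
  by rewrite !(team_of_fnd Ps) // => -[->] [->].
by exists (c x); rewrite /= !(team_of_fnd Ps) // cxy.
Qed.

Lemma holds_eq_app P n c f (z : 'I_(fun_ar f) -> var) y : P !=set0 ->
  (forall i, w <= z i < n) -> w <= y < n ->
  holds P n c (FAtom (Eq (App (fun i => Var (z i))) (Var y))) <->
  fun_int (fun i => c (z i)) = c y.
Proof.
move=> [g Pg] zn yn; split=> [H|fE s Ps].
  have Ps : team_of P n c (initial_assignment n (glue c g)) by exists g.
  have [a /=[[v [vE <-]]]] := H _ Ps.
  rewrite (team_of_fnd Ps) // => -[->]; congr fun_int.
  by apply: funext => i; move: (vE i); rewrite (team_of_fnd Ps) // => -[].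
exists (c y); rewrite /= (team_of_fnd Ps) //; split=> //.
by exists (fun i => c (z i)); split=> // i; rewrite (team_of_fnd Ps).
Qed.

Lemma holds_rel P n c R (z : 'I_(rel_ar R) -> var) : P !=set0 ->
  (forall i, w <= z i < n) ->
  holds P n c (FAtom (Rel (fun i => Var (z i)))) <-> rel_int (fun i => c (z i)).
Proof.
move=> [g Pg] zn; split=> [H|RE s Ps].
  have Ps : team_of P n c (initial_assignment n (glue c g)) by exists g.
  have [v /=[vE]] := H _ Ps.
  suff -> : v = fun i => c (z i) by [].
  by apply: funext => i; move: (vE i); rewrite (team_of_fnd Ps) // => -[].
by exists (fun i => c (z i)); split=> // i; rewrite /= (team_of_fnd Ps).
Qed.

(** * Blocks of quantifiers and finite conjunctions *)

Definition exists_block n k (phi : fot tau) := foldr (@FEx tau) phi (iota n k).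
Definition forall_block n k (phi : fot tau) := foldr (@FAll tau) phi (iota n k).

Lemma holds_exists_block P n k c phi : w <= n ->
  holds P n c (exists_block n k phi) <->
  exists2 c', (forall i, i < n -> c' i = c i) & holds P (n + k) c' phi.
Proof.
rewrite /exists_block; elim: k n c => [|k IHk] n c wn /=.
  rewrite addn0; split=> [|[c' c'E]]; first by exists c.
  (* For an empty block, [c'] can differ from [c] only outside the domain. *)
  by rewrite /holds (@eq_team_of _ _ _ c) // => i /andP[_ /c'E].
rewrite holds_ex // addnS -addSn; split.
  move=> [a /(IHk _ _ (leqW wn))[c' c'E H]]; exists c' => // i i_n.
  by rewrite c'E ?ltnS 1?ltnW //= ltn_eqF.
move=> [c' c'E H]; exists (c' n); apply/(IHk _ _ (leqW wn)); exists c' => // i.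
by rewrite ltnS /=; case: eqVneq => [->//|ni]; rewrite leq_eqVlt (negPf ni) => /c'E.
Qed.

Lemma holds_forall_block P n k c phi : w <= n ->
  holds P n c (forall_block n k phi) <->
  forall c', (forall i, i < n -> c' i = c i) -> holds P (n + k) c' phi.
Proof.
rewrite /forall_block; elim: k n c => [|k IHk] n c wn /=.
  rewrite addn0; split=> [H c' c'E|]; last exact.
  by rewrite /holds (@eq_team_of _ _ _ c) // => i /andP[_ /c'E].
rewrite holds_all // addnS -addSn; split.
  move=> H c' c'E; apply: (iffLR (IHk _ _ (leqW wn)) (H (c' n))) => i.
  by rewrite ltnS /=; case: eqVneq => [->//|ni]; rewrite leq_eqVlt (negPf ni) => /c'E.
move=> H a; apply/(IHk _ _ (leqW wn)) => c' c'E; apply: H => i i_n.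
by rewrite c'E ?ltnS 1?ltnW //= ltn_eqF.
Qed.

Definition true_fot : fot tau := FAtom (Eq (Var 0) (Var 0)).
Definition conj_fot (phis : seq (fot tau)) := foldr (@FAnd tau) true_fot phis.

Lemma true_fot_sat (X : set (assignment M)) :
  (forall s, X s -> 0 \in domf s) -> fot_sat X true_fot.
Proof.
by move=> X0 s /X0 s0; exists (s.[s0])%fmap; rewrite /= in_fnd.
Qed.

Lemma holds_true P n c : 0 < n -> holds P n c true_fot.
Proof.
move=> n0; apply: true_fot_sat => _ [g _ <-].
by rewrite -fndSome initial_assignmentE n0.
Qed.

Lemma holds_conj P n c (I : eqType) (s : seq I) (F : I -> fot tau) : 0 < n ->
  holds P n c (conj_fot (map F s)) <-> forall i, i \in s -> holds P n c (F i).
Proof.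
move=> n0; elim: s => [|i s IHs]; first by split=> // _; exact: holds_true.
split=> [[Hi /IHs Hs] j|H]; first by rewrite inE => /orP[/eqP->|/Hs].
split; first by apply: H; rewrite mem_head.
by apply/IHs => j js; apply: H; rewrite inE js orbT.
Qed.

End Teams.

(** * Function quantifiers as choices of subteams *)

Section Graphs.
Local Open Scope classical_set_scope.
Variables (tau : signature) (M : structure tau) (K D : nat).
Local Notation w := (K + D).
Implicit Types (f : nat -> seq M -> M) (Q : set (nat -> M)) (c g : nat -> M).

(** Columns below [K] hold the arguments and column [K + i] the value of function number [i];
    columns from [K + d] on are unconstrained. *)
Definition graphs d f : set (nat -> M) :=
  [set g | forall i, i < d -> g (K + i) = f i (mkseq g K)].

(** Function columns depend on the argument columns only, so all other columns can be prescribed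
    first and the function columns computed afterwards. *)
Lemma graphs_fill d f (b : nat -> M) :
  exists2 g, graphs d f g & forall i, (i < K) || (K + d <= i) -> g i = b i.
Proof.
pose g i := if (i < K) || (K + d <= i) then b i else f (i - K) (mkseq b K).
exists g => [i id|i ib]; last by rewrite /g ib.
rewrite /g ltnNge leq_addr leqNgt ltn_add2l id addKn; congr f.
by apply/eq_in_map => j; rewrite mem_iota add0n => /= ->.
Qed.

Lemma graphs_neq0 d f : graphs d f !=set0.
Proof.
case: (dom_inhabited M) => a.
by have [g] := graphs_fill d f (fun=> a); exists g.
Qed.

(** These are the columns that the choice of function number [d] must leave unconstrained. *)
Definition free_cols d := iota 0 K ++ iota (K + d.+1) (D - d.+1).

(** The first conjunct says that the arguments and the values of the columns
    after [d] are unconstrained, the second one that column [d] is a function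
    of the arguments. *)
Definition is_graph d n : fot tau :=
  forall_block n w.+1
    (FAnd (occurs tau (free_cols d) (map (addn n) (free_cols d)))
      (FOr (neq_seq tau (K + d :: iota 0 K) (n + (K + d) :: map (addn n) (iota 0 K)))
        (FOr (neq_seq tau (K + d :: iota 0 K) (n + w :: map (addn n) (iota 0 K)))
          (FAtom (Eq (Var (n + (K + d))) (Var (n + w))))))).

Lemma free_cols_lt d x : d < D -> x \in free_cols d -> x < w.
Proof.
move=> dD; rewrite mem_cat !mem_iota => /orP[|] /andP[_].
  by move=> xK; rewrite ltn_addr.
by rewrite -addnA subnKC.
Qed.

Lemma ex_block c n k (v : nat -> M) : exists2 c',
  (forall i, i < n -> c' i = c i) & forall i, i < k -> c' (n + i) = v i.
Proof.
exists (fun i => if i < n then c i else v (i - n)) => [i ->//|i _].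
by rewrite ltnNge leq_addr addKn.
Qed.

(** Constant [n + i] holds a wanted value for column [i], and [n + w] a second value for column [d].
    The nested disjunction is an implication in disguise: each inequality atom says that a row is
    missing, so if the arguments occur with both values, these are equal. *)
Lemma holds_is_graph Q d n c : Q !=set0 -> d < D -> w <= n ->
  holds w Q n c (is_graph d n) <->
  (forall b : nat -> M, exists2 g, Q g & {in free_cols d, g =1 b}) /\
  (forall g g', Q g -> Q g' -> mkseq g K = mkseq g' K -> g (K + d) = g' (K + d)).
Proof.
move=> Q0 dD wn; rewrite holds_forall_block //.
have wn' : w <= n + w.+1 by rewrite (leq_trans wn) // leq_addr.
have blk i : i < w.+1 -> w <= n + i < n + w.+1.
  by move=> iw; rewrite ltn_add2l iw (leq_trans wn) // leq_addr.
have iK : {in iota 0 K, forall i, i < w}.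
  by move=> i; rewrite mem_iota => /andP[_] iK; rewrite ltn_addr.
have Kdw : K + d < w by rewrite ltn_add2l.
have colw x : x \in K + d :: iota 0 K -> x < w.
  by rewrite inE => /orP[/eqP->//|/iK].
have blkw y m : m < w.+1 -> y \in n + m :: map (addn n) (iota 0 K) ->
    w <= y < n + w.+1.
  move=> mw; rewrite inE => /orP[/eqP->|/mapP[i /iK iw ->]]; apply: blk => //.
  exact: ltnW.
have neqE c' m : m < w.+1 -> holds w Q (n + w.+1) c' (neq_seq tau (K + d :: iota 0 K)
   (n + m :: map (addn n) (iota 0 K))) <-> forall g, Q g ->
   g (K + d) :: mkseq g K <> c' (n + m) :: mkseq (c' \o addn n) K.
  move=> mw; rewrite holds_neq_seq //=; first by rewrite -map_comp.
    by rewrite size_map.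
  by move=> y; apply: blkw.
have occE c' : holds w Q (n + w.+1) c' (occurs tau (free_cols d)
    (map (addn n) (free_cols d))) <->
    exists2 g, Q g & {in free_cols d, g =1 c' \o addn n}.
  rewrite holds_occurs ?size_map //; last 2 first.
  - by move=> x; apply: free_cols_lt.
  - by move=> _ /mapP[x /(free_cols_lt dD) xw ->]; apply: blk; apply: ltnW.
  rewrite -map_comp; split=> -[g Qg gE]; exists g => //; exact/eq_in_map.
split=> [H|[tot fn] c' _].
  split=> [b|g g' Qg Qg' gg'].
    have [c' c'n c'E] := ex_block c n w b.
    have [/occE[g Qg gE] _] := H _ c'n; exists g => // i ib.
    by rewrite gE //= c'E // (free_cols_lt dD).
  (* The constants copy the row [g] and the additional one takes the value of [g'] in column [d], so
     that both rows occur. *)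
  have [c' c'n c'E] := ex_block c n w.+1 (fun i => if i == w then g' (K + d) else g i).
  have mkE : mkseq (c' \o addn n) K = mkseq g K.
    apply/eq_in_map => i /iK iw /=; rewrite c'E 1?ltnW //.
    by rewrite ltn_eqF.
  have [_ /=[/neqE|[/neqE|]]] := H _ c'n.
  - move=> /(_ (ltnW Kdw)) /(_ g Qg); rewrite mkE c'E 1?ltnW //.
    by rewrite ltn_eqF // => /(_ erefl).
  - by move=> /(_ (leqnn _)) /(_ g' Qg'); rewrite mkE c'E // eqxx gg' => /(_ erefl).
  - move/(holds_eq_var _ Q0) => /(_ (blk _ (ltnW Kdw)) (blk _ (leqnn _))).
    by rewrite !c'E ?eqxx // 1?ltnW // ltn_eqF.
split; first by apply/occE.
have [|] := pselect (holds w Q (n + w.+1) c' (neq_seq tau (K + d :: iota 0 K)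
   (n + (K + d) :: map (addn n) (iota 0 K)))); first by left.
rewrite neqE 1?ltnW // => /existsNP[g /not_implyP[Qg /contrapT [gd gE]]]; right.
have [|] := pselect (holds w Q (n + w.+1) c' (neq_seq tau (K + d :: iota 0 K)
   (n + w :: map (addn n) (iota 0 K)))); first by left.
rewrite neqE // => /existsNP[g' /not_implyP[Qg' /contrapT [gd' gE']]]; right.
apply/(holds_eq_var _ Q0); rewrite ?blk // 1?ltnW // -gd -gd'.
by apply: fn => //; rewrite gE gE'.
Qed.

(** The dual of the implication asserts a nonempty subteam with both properties: the empty one is
    discarded because it satisfies every dotted negation. *)
Definition exists_fun d n (phi : fot tau) := FNot (FImp (is_graph d n) (FNot phi)).

(** A witnessing subteam is functional in column [d] and so defines [h]; being total in the
    remaining columns, it is as large as the graph of [h]. *)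
Lemma holds_exists_fun d f n c phi : d < D -> w <= n ->
  holds w (graphs d f) n c (exists_fun d n phi) <->
  exists h, holds w (graphs d.+1 [eta f with d |-> h]) n c phi.
Proof.
move=> dD wn.
have graphsS h g : graphs d.+1 [eta f with d |-> h] g <->
    graphs d f g /\ g (K + d) = h (mkseq g K).
  split=> [H|[H gd] i].
    split=> [i id|]; last by rewrite H //= eqxx.
    by rewrite H /= ?ltn_eqF // ltnS ltnW.
  by rewrite ltnS leq_eqVlt /=; case: eqVneq => [->|_ /H].
rewrite holds_not ?holds_imp; last exact: graphs_neq0.
split.
  move=> /existsNP[Q /not_implyP[Qf /not_implyP[gQ]]].
  have [->|/set0P Q0] := eqVneq Q set0.
    by case; left; apply/team_of_eq0.
  rewrite holds_not // => /contrapT Hphi.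
  move/(holds_is_graph _ Q0 dD wn): gQ => [tot fn].
  (* Every list of [K] arguments occurs in [Q], so the arbitrary value serves only lists of another
     length. *)
  have /choice[h hE] l : exists y, forall g, Q g -> mkseq g K = l -> g (K + d) = y.
    have [[g [Qg gl]]|nQ] := pselect (exists g, Q g /\ mkseq g K = l).
      by exists (g (K + d)) => g' Qg' g'l; apply: fn; rewrite // g'l gl.
    case: (dom_inhabited M) => a; exists a => g Qg gl.
    by case: nQ; exists g.
  exists h; rewrite /holds.
  suff <- : team_of w Q n c = team_of w (graphs d.+1 [eta f with d |-> h]) n c by [].
  apply/seteqP; split; apply: team_of_cols => g Hg.
    by exists g => //; apply/graphsS; split; [exact: Qf|exact: hE].
  (* Totality gives a row [g'] of [Q] with the arguments and later columns of [g]; the columns up to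
     [d] then agree too, since both rows take them from the same functions. *)
  move/graphsS: Hg => [Hg gd]; have [g' Qg' g'E] := tot g; exists g' => // i iw.
  have mkE : mkseq g' K = mkseq g K.
    by apply/eq_in_map => j jK; rewrite g'E // mem_cat jK.
  have [iK|Ki] := ltnP i K; first by rewrite g'E // mem_cat mem_iota iK.
  move: iw; rewrite -(subnKC Ki) ltn_add2l => iD.
  have [id|di|->] := ltngtP (i - K) d.
  - by rewrite Hg // (Qf _ Qg') // mkE.
  - rewrite g'E // mem_cat [X in _ || X]mem_iota.
    by rewrite -(addnA K d.+1) (subnKC dD) ltn_add2l leq_add2l di iD orbT.
  - by rewrite gd (hE _ _ Qg' mkE).
(* Conversely, the graph of [h] itself is the required subteam. *)
move=> [h Hphi] /(_ (graphs d.+1 [eta f with d |-> h])) H.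
have N0 := graphs_neq0 d.+1 [eta f with d |-> h].
have /H : graphs d.+1 [eta f with d |-> h] `<=` graphs d f by move=> g /graphsS[].
rewrite holds_not // holds_is_graph //; apply=> //; split=> [b|g g'].
  have [g Hg gE] := graphs_fill d.+1 [eta f with d |-> h] b.
  exists g => // i; rewrite mem_cat !mem_iota => ib; apply: gE.
  by move: ib => /orP[/andP[_ ->//]|/andP[->]]; rewrite orbT.
by move=> /graphsS[_ ->] /graphsS[_ ->] ->.
Qed.

End Graphs.

(** * Translation of second-order formulas *)

Section Translation.
Variables (tau : signature) (K D : nat).
Local Notation w := (K + D).

(** All functions share [K] argument columns, so a shorter tuple is padded with the variable [w],
    the first constant, whose value serves as base point. *)
Definition args n k : seq var := mkseq (nth w (iota n k)) K.

Definition fun_eq i n k y : fot tau := occurs tau (K + i :: iota 0 K) (y :: args n k).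

Fixpoint tr_term (e : var -> var) (ef : sovar -> nat) n (t : term (so_sig tau)) y :
    fot tau :=
  match t with
  | Var x => FAtom (Eq (Var (e x)) (Var y))
  | App f ts =>
      let k := fun_ar f in
      exists_block n k
        (FAnd (conj_fot [seq tr_term e ef (n + k) (ts i) (n + i) | i : 'I_k])
          (match f with
           | inl f => FAtom (Eq (App (fun i : 'I_(fun_ar f) => Var (n + i))) (Var y))
           | inr F => fun_eq (ef F) n F.1 y
           end))
  end.

(** A relation variable is represented by a function, which takes the value of
    [w] exactly on the tuples of the relation. *)
Definition tr_atom (e : var -> var) (er ef : sovar -> nat) n
    (l : atom (so_sig tau)) : fot tau :=
  match l with
  | Rel R ts =>
      let k := rel_ar R in
      exists_block n k
        (FAnd (conj_fot [seq tr_term e ef (n + k) (ts i) (n + i) | i : 'I_k])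
          (match R with
           | inl R => FAtom (Rel (fun i : 'I_(rel_ar R) => Var (n + i)))
           | inr X => fun_eq (er X) n X.1 w
           end))
  | Eq t u => FEx n (FAnd (tr_term e ef n.+1 t n) (tr_term e ef n.+1 u n))
  end.

(** The number of function columns in use is [d]. Universal second-order quantifiers are reduced to
    [exists_fun] by duality, so that one semantic lemma serves all four cases. *)
Fixpoint tr (e : var -> var) (er ef : sovar -> nat) d n (phi : so tau) : fot tau :=
  match phi with
  | SAtom l => tr_atom e er ef n l
  | SNot phi => FNot (tr e er ef d n phi)
  | SAnd phi psi => FAnd (tr e er ef d n phi) (tr e er ef d n psi)
  | SOr phi psi => FOr (tr e er ef d n phi) (tr e er ef d n psi)
  | SEx x phi => FEx n (tr [eta e with x |-> n] er ef d n.+1 phi)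
  | SAll x phi => FAll n (tr [eta e with x |-> n] er ef d n.+1 phi)
  | SExR X phi => exists_fun K D d n (tr e [eta er with X |-> d] ef d.+1 n phi)
  | SAllR X phi =>
      FNot (exists_fun K D d n (FNot (tr e [eta er with X |-> d] ef d.+1 n phi)))
  | SExF F phi => exists_fun K D d n (tr e er [eta ef with F |-> d] d.+1 n phi)
  | SAllF F phi =>
      FNot (exists_fun K D d n (FNot (tr e er [eta ef with F |-> d] d.+1 n phi)))
  end.

(** * Values of terms and atoms on teams of graphs *)

Variable M : structure tau.
Implicit Types (f : nat -> seq M -> M) (c : nat -> M) (s : assignment M).

(** Semantic counterpart of [args], with [a] as base point. *)
Definition pad (a : M) k (v : 'I_k -> M) : seq M := mkseq (nth a (codom v)) K.

Lemma nth_pad (a b : M) k (v : 'I_k -> M) (i : 'I_k) : k <= K -> nth b (pad a v) i = v i.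
Proof.
move=> kK; rewrite nth_mkseq ?(leq_trans (ltn_ord i)) //.
by rewrite (nth_map i) ?size_enum_ord // nth_ord_enum.
Qed.

Lemma map_args c n k : map c (args n k) = pad (c w) (fun i : 'I_k => c (n + i)).
Proof.
rewrite /args /pad -map_comp; apply: eq_map => i /=.
have -> : codom (fun i : 'I_k => c (n + i)) = map c (iota n k).
  by rewrite codomE -[in RHS](addn0 n) iotaDl -val_enum_ord -!map_comp.
have [ik|ki] := ltnP i k; first by rewrite (nth_map w) ?size_iota.
by rewrite !nth_default ?size_map ?size_iota.
Qed.

Lemma args_lt n k m y : w < m -> w <= n -> n + k <= m -> y \in args n k -> w <= y < m.
Proof.
move=> wm wn nkm /mapP[i _ ->].
have [ik|ki] := ltnP i k; last by rewrite nth_default ?size_iota // leqnn.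
rewrite nth_iota // (leq_trans wn) ?leq_addr //=.
by rewrite (leq_trans _ nkm) // ltn_add2l.
Qed.

(** The arguments range over all tuples in the team, so the row made of a value and the padded
    arguments occurs exactly when the function takes that value there. *)
Lemma holds_fun_eq f c d i n k m y : i < d -> d <= D -> w <= n -> n + k <= m ->
    w <= y < m ->
  holds w (graphs K d f) m c (fun_eq i n k y) <->
  f i (pad (c w) (fun j : 'I_k => c (n + j))) = c y.
Proof.
move=> id dD wn nkm ym; have wm : w < m.
  by case/andP: ym => wy ym; exact: leq_ltn_trans ym.
rewrite holds_occurs //=; first last.
- by move=> z; rewrite inE => /orP[/eqP->//|]; apply: args_lt.
- move=> x; rewrite inE mem_iota => /orP[/eqP->|/andP[_ xK]].
    by rewrite ltn_add2l (leq_trans id).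
  by rewrite ltn_addr.
- by rewrite size_iota size_mkseq.
- exact: ltnW.
- exact: graphs_neq0.
rewrite map_args; split=> [[g Hg [gi gE]]|fE].
  by rewrite -gE -gi Hg.
have [g Hg gE] := graphs_fill K d f (nth (c w) (pad (c w) (fun j : 'I_k => c (n + j)))).
have mkE : mkseq g K = pad (c w) (fun j : 'I_k => c (n + j)).
  rewrite -[RHS](mkseq_nth (c w)) size_mkseq; apply/eq_in_map => j.
  by rewrite mem_iota => /andP[_ jK]; rewrite gE ?jK.
by exists g => //; rewrite -[map g _]/(mkseq g K) Hg // mkE fE.
Qed.

(** Agreement is demanded on padded tuples only, the only places where the translation consults the
    column. *)
Definition fun_rep f c d (ef : sovar -> nat) (VF : fun_valuation M) (F : sovar) :=
  ef F < d /\ forall v, f (ef F) (pad (c w) v) = VF F v.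

Definition rel_rep f c d (er : sovar -> nat) (VR : rel_valuation M) (X : sovar) :=
  er X < d /\ forall v, VR X v <-> f (er X) (pad (c w) v) = c w.

Lemma ex_ord_block c n k (v : 'I_k -> M) : exists2 c',
  (forall i, i < n -> c' i = c i) & forall i : 'I_k, c' (n + i) = v i.
Proof.
have [c' c'n c'E] := ex_block c n k (nth (c w) (codom v)).
exists c' => // i; rewrite c'E //.
by rewrite (nth_map i) ?size_enum_ord // nth_ord_enum.
Qed.

(* Flattening: the values of the subterms are quantified, as a block of
   constants, before the head symbol is applied. *)
Lemma holds_flatten f c d n k (tphi : 'I_k -> fot tau) psi
    (T : 'I_k -> M -> Prop) (B : ('I_k -> M) -> Prop) :
  w < n ->
  (forall c' i, (forall j, j < n -> c' j = c j) ->
     holds w (graphs K d f) (n + k) c' (tphi i) <-> T i (c' (n + i))) ->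
  (forall c', (forall j, j < n -> c' j = c j) ->
     holds w (graphs K d f) (n + k) c' psi <-> B (fun i => c' (n + i))) ->
  holds w (graphs K d f) n c
    (exists_block n k (FAnd (conj_fot [seq tphi i | i : 'I_k]) psi)) <->
  exists v, (forall i, T i (v i)) /\ B v.
Proof.
move=> wn tphiP psiP; rewrite holds_exists_block 1?ltnW //.
have nk0 : 0 < n + k by rewrite addn_gt0 (leq_ltn_trans _ wn).
split.
  move=> [c' c'n [/(holds_conj _ _ _ _ _ nk0) H /psiP Hpsi]].
  exists (fun i => c' (n + i)); split; last exact: Hpsi.
  by move=> i; apply/tphiP => //; apply: H; rewrite mem_enum.
move=> [v [Tv Bv]]; have [c' c'n c'E] := ex_ord_block c n v.
exists c' => //; split.
  by apply/holds_conj => // i _; apply/tphiP => //; rewrite c'E.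
by apply/psiP => //; rewrite (_ : (fun i => _) = v) //; apply: funext.
Qed.

Lemma tr_termP e ef VR VF f c d n s t y :
    (forall x, w <= e x < n) -> w <= y < n -> d <= D ->
    (forall x, x \in term_vars t -> s.[? x]%fmap = Some (c (e x))) ->
    (forall F, F \in term_fun_vars t -> fun_rep f c d ef VF F) ->
  holds w (graphs K d f) n c (tr_term e ef n t y) <->
  @term_val (so_sig tau) (so_expand VR VF) s t (c y).
Proof.
elim: t c n y => [x|g ts IH] c n y en yn dD Hs HF.
  rewrite /= holds_eq_var //; last exact: graphs_neq0.
  rewrite Hs ?inE //; split=> [->|[]] //.
have wn : w < n by case/andP: (yn) => wy; apply: leq_ltn_trans.
rewrite [tr_term _ _ _ _ _]/= -/tr_term.
have sub i : forall x, x \in term_vars (ts i) -> x \in term_vars (App ts).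
  by move=> x xi; apply/bigfcupP; exists i; rewrite ?mem_index_enum.
have subF i : forall x, x \in term_fun_vars (ts i) -> x \in term_fun_vars (App ts).
  move=> x xi; rewrite inE; apply/orP; right.
  by apply/bigfcupP; exists i; rewrite ?mem_index_enum.
have wnk (i : 'I_(fun_ar g)) : w <= n + i < n + fun_ar g.
  by rewrite ltn_add2l ltn_ord andbT (leq_trans (ltnW wn)) // leq_addr.
apply: (@holds_flatten _ _ _ _ _ _ _
  (fun i a => @term_val (so_sig tau) (so_expand VR VF) s (ts i) a)
  (fun v => @fun_int (so_sig tau) (so_expand VR VF) g v = c y)) => //.
  move=> c' i c'n; apply: IH => //.
  - by move=> x; case/andP: (en x) => -> /= ?; rewrite ltn_addr.
  - by move=> x /sub /Hs ->; rewrite c'n //; case/andP: (en x).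
  - by move=> F /subF /HF; rewrite /fun_rep c'n.
move=> c' c'n; have yc' : c' y = c y by rewrite c'n //; case/andP: yn.
have ynk : w <= y < n + fun_ar g by case/andP: yn => -> /= ?; rewrite ltn_addr.
rewrite -yc'; case: g ts IH Hs HF sub subF wnk ynk => [g|F] ts IH Hs HF sub subF wnk ynk.
  by apply: holds_eq_app => //; exact: graphs_neq0.
have [Fd FE] : fun_rep f c d ef VF F by apply: HF; rewrite !inE eqxx.
rewrite holds_fun_eq //; last exact: ltnW.
by rewrite c'n // FE.
Qed.

Lemma tr_atomP e er ef VR VF f c d n s l :
    (forall x, w <= e x < n) -> w < n -> d <= D ->
    (forall x, x \in atom_vars l -> s.[? x]%fmap = Some (c (e x))) ->
    (forall X, X \in atom_rel_vars l -> rel_rep f c d er VR X) ->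
    (forall F, F \in atom_fun_vars l -> fun_rep f c d ef VF F) ->
  holds w (graphs K d f) n c (tr_atom e er ef n l) <->
  @atom_sat (so_sig tau) (so_expand VR VF) s l.
Proof.
move=> en wn dD; case: l => [R ts|t u] Hs HX HF; last first.
  have tP t' a : (term_vars t' `<=` atom_vars (Eq t u))%fset ->
      (term_fun_vars t' `<=` atom_fun_vars (Eq t u))%fset ->
      holds w (graphs K d f) n.+1 [eta c with n |-> a] (tr_term e ef n.+1 t' n) <->
      @term_val (so_sig tau) (so_expand VR VF) s t' a.
    move=> /fsubsetP sub /fsubsetP subF.
    (* The lemma on terms speaks of the value of a constant, so [a] is presented as the value at
       [n]. *)
    have {2}-> : a = [eta c with n |-> a] n by rewrite /= eqxx.
    apply: tr_termP => //.
    - by move=> x; case/andP: (en x) => -> /= ?; rewrite ltnW.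
    - by rewrite ltnS leqnn ltnW.
    - by move=> x /sub /Hs -> /=; rewrite ltn_eqF //; case/andP: (en x).
    - by move=> F /subF /HF; rewrite /fun_rep /= ltn_eqF.
  rewrite /= holds_ex 1?ltnW //; split=> -[a [Ht Hu]]; exists a.
    by split; apply/tP; rewrite ?fsubsetUl ?fsubsetUr.
  by split; apply/tP; rewrite ?fsubsetUl ?fsubsetUr.
rewrite [tr_atom _ _ _ _ _]/=.
have sub i : forall x, x \in term_vars (ts i) -> x \in atom_vars (Rel ts).
  by move=> x xi; apply/bigfcupP; exists i; rewrite ?mem_index_enum.
have subF i : forall x, x \in term_fun_vars (ts i) -> x \in atom_fun_vars (Rel ts).
  by move=> x xi; apply/bigfcupP; exists i; rewrite ?mem_index_enum.
have wnk (i : 'I_(rel_ar R)) : w <= n + i < n + rel_ar R.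
  by rewrite ltn_add2l ltn_ord andbT (leq_trans (ltnW wn)) // leq_addr.
apply: (@holds_flatten _ _ _ _ _ _ _
  (fun i a => @term_val (so_sig tau) (so_expand VR VF) s (ts i) a)
  (fun v => @rel_int (so_sig tau) (so_expand VR VF) R v)) => //.
  move=> c' i c'n; apply: tr_termP => //.
  - by move=> x; case/andP: (en x) => -> /= ?; rewrite ltn_addr.
  - by move=> x /sub /Hs ->; rewrite c'n //; case/andP: (en x).
  - by move=> F /subF /HF; rewrite /fun_rep c'n.
move=> c' c'n; case: R ts Hs HX HF sub subF wnk => [R|X] ts Hs HX HF sub subF wnk.
  by apply: holds_rel => //; exact: graphs_neq0.
have [Xd XE] : rel_rep f c d er VR X by apply: HX; rewrite inE.
rewrite holds_fun_eq //; last 2 first.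
- exact: ltnW.
- by rewrite leqnn ltn_addr.
by rewrite c'n //; split=> /XE.
Qed.

(** * Resource bounds and correctness for all formulas *)

(** Bounds the number of value columns: nested quantifiers need different ones, while the two sides
    of a connective share theirs. *)
Fixpoint so_depth (phi : so tau) : nat :=
  match phi with
  | SAtom _ => 0
  | SAnd phi psi | SOr phi psi => maxn (so_depth phi) (so_depth psi)
  | SNot phi | SEx _ phi | SAll _ phi => so_depth phi
  | SExR _ phi | SAllR _ phi | SExF _ phi | SAllF _ phi => (so_depth phi).+1
  end.

(** In a sentence every second-order variable is quantified, so this bounds the number of argument
    columns. *)
Fixpoint so_arity (phi : so tau) : nat :=
  match phi with
  | SAtom _ => 0
  | SAnd phi psi | SOr phi psi => maxn (so_arity phi) (so_arity psi)
  | SNot phi | SEx _ phi | SAll _ phi => so_arity phi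
  | SExR X phi | SAllR X phi | SExF X phi | SAllF X phi => maxn X.1 (so_arity phi)
  end.

Lemma pad_fun (a : M) k (F : nfun M k) : k <= K ->
  exists h : seq M -> M, forall v, h (pad a v) = F v.
Proof.
move=> kK; exists (fun l => F (fun i => nth a l i)) => v.
by congr F; apply: funext => i; rewrite nth_pad.
Qed.

(** The function is a characteristic function with values [a] and [b], and padding is injective
    because [k <= K]. *)
Lemma pad_rel (a : M) k (R : nrel M k) : k <= K -> (exists b : M, b <> a) ->
  exists h : seq M -> M, forall v, R v <-> h (pad a v) = a.
Proof.
move=> kK [b ba].
have [h hE] := pad_fun a (fun v => if `[< R v >] then a else b) kK.
by exists h => v; rewrite hE; case: asboolP.
Qed.

Lemma fun_rep_fresh f h c d ef VF F : fun_rep f c d ef VF F ->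
  fun_rep [eta f with d |-> h] c d.+1 ef VF F.
Proof. by move=> [Fd FE]; split=> [|v]; [exact: ltnW|rewrite /= ltn_eqF]. Qed.

Lemma rel_rep_fresh f h c d er VR X : rel_rep f c d er VR X ->
  rel_rep [eta f with d |-> h] c d.+1 er VR X.
Proof. by move=> [Xd XE]; split=> [|v]; [exact: ltnW|rewrite /= ltn_eqF]. Qed.

(** The new column is numbered [d] and all columns in use are numbered below [d], so the other
    variables keep their representation. *)
Lemma fun_rep_set f h c d ef VF F (g : nfun M F.1) G :
  (forall v, h (pad (c w) v) = g v) ->
  (G != F -> fun_rep f c d ef VF G) ->
  fun_rep [eta f with d |-> h] c d.+1 [eta ef with F |-> d] (dfwith VF g) G.
Proof.
move=> hg HG; case: (eqVneq G F) HG => [->|GF] HG.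
  by split=> [|v]; rewrite /= !eqxx // dfwith_in.
have [Gd GE] := fun_rep_fresh h (HG isT).
split=> [|v]; first by rewrite /= (negPf GF).
by rewrite dfwith_out 1?eq_sym //= (negPf GF) -GE.
Qed.

Lemma rel_rep_set f h c d er VR X (R : nrel M X.1) Y :
  (forall v, R v <-> h (pad (c w) v) = c w) ->
  (Y != X -> rel_rep f c d er VR Y) ->
  rel_rep [eta f with d |-> h] c d.+1 [eta er with X |-> d] (dfwith VR R) Y.
Proof.
move=> hR HY; case: (eqVneq Y X) HY => [->|YX] HY.
  by split=> [|v]; rewrite /= !eqxx // dfwith_in.
have [Yd YE] := rel_rep_fresh h (HY isT).
split=> [|v]; first by rewrite /= (negPf YX).
by rewrite dfwith_out 1?eq_sym //= (negPf YX) YE.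
Qed.

(** Stated as a predicate so that it can be the induction hypothesis of the three lemmas below. The
    element [b] distinct from the base point is the second value needed for coding relations. *)
Definition tr_correct phi := forall e er ef VR VF f c d n s,
    (forall x, w <= e x < n) -> w < n -> d + so_depth phi <= D ->
    so_arity phi <= K -> (exists b : M, b <> c w) ->
    (forall x, x \in so_fv phi -> s.[? x]%fmap = Some (c (e x))) ->
    (forall X, X \in so_fv_rel phi -> rel_rep f c d er VR X) ->
    (forall F, F \in so_fv_fun phi -> fun_rep f c d ef VF F) ->
  holds w (graphs K d f) n c (tr e er ef d n phi) <-> so_sat VR VF s phi.

Lemma tr_correct_fo phi : tr_correct phi ->
  forall e er ef VR VF f c d n s x a,
    (forall x, w <= e x < n) -> w < n -> d + so_depth phi <= D ->
    so_arity phi <= K -> (exists b : M, b <> c w) ->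
    (forall y, y \in so_fv phi `\ x -> s.[? y] = Some (c (e y)))%fset%fmap ->
    (forall X, X \in so_fv_rel phi -> rel_rep f c d er VR X) ->
    (forall F, F \in so_fv_fun phi -> fun_rep f c d ef VF F) ->
  holds w (graphs K d f) n.+1 [eta c with n |-> a]
    (tr [eta e with x |-> n] er ef d n.+1 phi) <-> so_sat VR VF s.[x <- a]%fmap phi.
Proof.
move=> IH e er ef VR VF f c d n s x a en wn dD aK b Hs HX HF.
have nw : (w == n) = false by rewrite ltn_eqF.
apply: IH => //.
- move=> y /=; case: ifP => _; first by rewrite ltnS leqnn ltnW.
  by case/andP: (en y) => -> /= ?; rewrite ltnW.
- exact: ltnW.
- by rewrite /= nw.
- move=> y yphi; rewrite fnd_set /=; case: eqVneq => [_|yx]; first by rewrite eqxx.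
  rewrite Hs ?inE ?yx //= ltn_eqF //; by case/andP: (en y).
- by move=> X /HX; rewrite /rel_rep /= nw.
- by move=> F /HF; rewrite /fun_rep /= nw.
Qed.

(** A back-and-forth between relations and functions: a relation is coded by a two-valued function,
    and any [h] codes the relation on which it takes the base point as value. One direction alone
    would not serve both quantifiers. *)
Lemma tr_correct_rel phi : tr_correct phi ->
  forall e er ef VR VF f c d n s X,
    (forall x, w <= e x < n) -> w < n -> d + (so_depth phi).+1 <= D ->
    maxn X.1 (so_arity phi) <= K -> (exists b : M, b <> c w) ->
    (forall x, x \in so_fv phi -> s.[? x]%fmap = Some (c (e x))) ->
    (forall Y, Y \in so_fv_rel phi `\ X -> rel_rep f c d er VR Y)%fset ->
    (forall F, F \in so_fv_fun phi -> fun_rep f c d ef VF F) ->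
  (forall R : nrel M X.1, exists h,
    holds w (graphs K d.+1 [eta f with d |-> h]) n c
      (tr e [eta er with X |-> d] ef d.+1 n phi) <-> so_sat (dfwith VR R) VF s phi) /\
  (forall h, exists R : nrel M X.1,
    holds w (graphs K d.+1 [eta f with d |-> h]) n c
      (tr e [eta er with X |-> d] ef d.+1 n phi) <-> so_sat (dfwith VR R) VF s phi).
Proof.
move=> IH e er ef VR VF f c d n s X en wn dD; rewrite geq_max => /andP[XK aK] b Hs HX HF.
have E (R : nrel M X.1) h : (forall v, R v <-> h (pad (c w) v) = c w) ->
    holds w (graphs K d.+1 [eta f with d |-> h]) n c
      (tr e [eta er with X |-> d] ef d.+1 n phi) <-> so_sat (dfwith VR R) VF s phi.
  move=> Rh; apply: IH => //; first by rewrite addSnnS.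
    by move=> Y Yphi; apply: rel_rep_set => // YX; apply: HX; rewrite !inE YX.
  by move=> F /HF; apply: fun_rep_fresh.
split=> [R|h]; first by have [h hE] := pad_rel R XK b; exists h; apply: E.
by exists (fun v => h (pad (c w) v) = c w); apply: E.
Qed.

Lemma tr_correct_fun phi : tr_correct phi ->
  forall e er ef VR VF f c d n s F,
    (forall x, w <= e x < n) -> w < n -> d + (so_depth phi).+1 <= D ->
    maxn F.1 (so_arity phi) <= K -> (exists b : M, b <> c w) ->
    (forall x, x \in so_fv phi -> s.[? x]%fmap = Some (c (e x))) ->
    (forall X, X \in so_fv_rel phi -> rel_rep f c d er VR X) ->
    (forall G, G \in so_fv_fun phi `\ F -> fun_rep f c d ef VF G)%fset ->
  (forall g : nfun M F.1, exists h,
    holds w (graphs K d.+1 [eta f with d |-> h]) n c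
      (tr e er [eta ef with F |-> d] d.+1 n phi) <-> so_sat VR (dfwith VF g) s phi) /\
  (forall h, exists g : nfun M F.1,
    holds w (graphs K d.+1 [eta f with d |-> h]) n c
      (tr e er [eta ef with F |-> d] d.+1 n phi) <-> so_sat VR (dfwith VF g) s phi).
Proof.
move=> IH e er ef VR VF f c d n s F en wn dD; rewrite geq_max => /andP[FK aK] b Hs HX HF.
have E (g : nfun M F.1) h : (forall v, h (pad (c w) v) = g v) ->
    holds w (graphs K d.+1 [eta f with d |-> h]) n c
      (tr e er [eta ef with F |-> d] d.+1 n phi) <-> so_sat VR (dfwith VF g) s phi.
  move=> gh; apply: IH => //; first by rewrite addSnnS.
    by move=> X /HX; apply: rel_rep_fresh.
  by move=> G Gphi; apply: fun_rep_set => // GF; apply: HF; rewrite !inE GF.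
split=> [g|h]; first by have [h hE] := pad_fun (c w) g FK; exists h; apply: E.
by exists (fun v => h (pad (c w) v)); apply: E.
Qed.

Lemma trP phi : tr_correct phi.
Proof.
elim: phi => [l|phi IH|phi IH psi IH'|phi IH psi IH'|x phi IH|x phi IH|X phi IH|X phi IH
    |F phi IH|F phi IH] e er ef VR VF f c d n s en wn /= dD aK b Hs HX HF.
- by apply: tr_atomP => //; apply: leq_trans dD; rewrite leq_addr.
- rewrite holds_not; last exact: graphs_neq0.
  by rewrite (IH _ _ _ VR VF _ _ _ _ s).
- move: dD aK; rewrite addn_maxr !geq_max => /andP[d1 d2] /andP[a1 a2].
  rewrite /holds /= -!/(holds _ _ _ _ _).
  rewrite (IH _ _ _ VR VF _ _ _ _ s) // ?(IH' _ _ _ VR VF _ _ _ _ s) // => x xp;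
    (by first [apply: Hs|apply: HX|apply: HF]; rewrite inE xp ?orbT).
- move: dD aK; rewrite addn_maxr !geq_max => /andP[d1 d2] /andP[a1 a2].
  rewrite /holds /= -!/(holds _ _ _ _ _).
  rewrite (IH _ _ _ VR VF _ _ _ _ s) // ?(IH' _ _ _ VR VF _ _ _ _ s) // => x xp;
    (by first [apply: Hs|apply: HX|apply: HF]; rewrite inE xp ?orbT).
- rewrite holds_ex 1?ltnW //.
  by split=> -[a Ha]; exists a; move: Ha; apply tr_correct_fo.
- rewrite holds_all 1?ltnW //.
  by split=> H a; move: (H a); apply tr_correct_fo.
(* The depth bound counts the quantifier at hand, so column [d] still exists. *)
all: have dD' : d < D by apply: leq_trans dD; rewrite addnS ltnS leq_addr.
all: have wn' := ltnW wn.
- have [RH HR] := tr_correct_rel IH en wn dD aK b Hs HX HF.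
  rewrite holds_exists_fun //; split.
    by move=> [h]; have [R ->] := HR h; exists R.
  by move=> [R]; have [h <-] := RH R; exists h.
- have [RH HR] := tr_correct_rel IH en wn dD aK b Hs HX HF.
  rewrite holds_not ?holds_exists_fun //; last exact: graphs_neq0.
  (* The universal quantifier is the absence of a counterexample, transferred between [R] and a
     function coding it. *)
  split=> [H R|H [h]].
    apply: contrapT => nR; apply: H; have [h hR] := RH R; exists h.
    by apply/holds_not; [exact: graphs_neq0|rewrite hR].
  by rewrite holds_not; [have [R ->] := HR h; apply|exact: graphs_neq0].
- have [RH HR] := tr_correct_fun IH en wn dD aK b Hs HX HF.
  rewrite holds_exists_fun //; split.
    by move=> [h]; have [R ->] := HR h; exists R.
  by move=> [R]; have [h <-] := RH R; exists h.
- have [RH HR] := tr_correct_fun IH en wn dD aK b Hs HX HF.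
  rewrite holds_not ?holds_exists_fun //; last exact: graphs_neq0.
  split=> [H R|H [h]].
    apply: contrapT => nR; apply: H; have [h hR] := RH R; exists h.
    by apply/holds_not; [exact: graphs_neq0|rewrite hR].
  by rewrite holds_not; [have [R ->] := HR h; apply|exact: graphs_neq0].
Qed.

End Translation.

(** * Free variables of the translated formulas *)

Section FreeVariables.
Variable tau : signature.
Implicit Types (phi psi : fot tau) (n : nat).

Definition fv_below n phi := {in fot_fv phi, forall i, i < n}.

Lemma fv_below_and n phi psi :
  fv_below n phi -> fv_below n psi -> fv_below n (FAnd phi psi).
Proof. by move=> Hp Hq i; rewrite inE => /orP[/Hp|/Hq]. Qed.

Lemma fv_below_or n phi psi :
  fv_below n phi -> fv_below n psi -> fv_below n (FOr phi psi).
Proof. exact: fv_below_and. Qed.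

Lemma fv_below_ex n phi : fv_below n.+1 phi -> fv_below n (FEx n phi).
Proof.
move=> H i; rewrite !inE => /andP[i_n /H].
by rewrite ltnS leq_eqVlt (negPf i_n).
Qed.

Lemma fv_below_all n phi : fv_below n.+1 phi -> fv_below n (FAll n phi).
Proof. exact: fv_below_ex. Qed.

Lemma fv_below_exists_block n k phi :
  fv_below (n + k) phi -> fv_below n (exists_block n k phi).
Proof.
rewrite /exists_block; elim: k n => [|k IHk] n /=; first by rewrite addn0.
by rewrite addnS -addSn => /IHk /fv_below_ex.
Qed.

Lemma fv_below_forall_block n k phi :
  fv_below (n + k) phi -> fv_below n (forall_block n k phi).
Proof.
rewrite /forall_block; elim: k n => [|k IHk] n /=; first by rewrite addn0.
by rewrite addnS -addSn => /IHk /fv_below_all.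
Qed.

Lemma fv_below_neq_seq n xs ys : size xs = size ys ->
  {in xs, forall i, i < n} -> {in ys, forall i, i < n} ->
  fv_below n (neq_seq tau xs ys).
Proof.
move=> sz xn yn i; rewrite /= -/(unzip1 _) -/(unzip2 _) unzip1_zip ?unzip2_zip ?sz //.
by rewrite !inE => /orP[/xn|/yn].
Qed.

Lemma fv_below_true n : 0 < n -> fv_below n (true_fot tau).
Proof. by move=> n0 i; rewrite /= !inE orbb => /eqP->. Qed.

Lemma fv_below_conj n (I : eqType) (s : seq I) (F : I -> fot tau) : 0 < n ->
  (forall i, fv_below n (F i)) -> fv_below n (conj_fot (map F s)).
Proof.
move=> n0 H; elim: s => [|i s IHs]; first exact: fv_below_true.
exact: (fv_below_and (H i) IHs).
Qed.

Lemma fv_below_eq_var n x y : x < n -> y < n ->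
  fv_below n (FAtom (Eq (Var x) (Var y))).
Proof. by move=> xn yn i; rewrite /= !inE => /orP[] /eqP->. Qed.

Lemma var_bigcup k (z : 'I_k -> var) n : (forall i, z i < n) ->
  {in (\bigcup_(i in 'I_k) term_vars (@Var tau (z i)))%fset, forall i, i < n}.
Proof. by move=> zn i /bigfcupP[j _]; rewrite inE => /eqP->. Qed.

Variables K D : nat.
Local Notation w := (K + D).

Lemma fv_below_is_graph d n : d < D -> w <= n -> fv_below n (@is_graph tau K D d n).
Proof.
move=> dD wn; apply: fv_below_forall_block.
have low x : x < w -> x < n + w.+1 by move=> xw; rewrite ltn_addr // (leq_trans xw).
have lown x : x <= w -> n + x < n + w.+1 by move=> xw; rewrite ltn_add2l.
have iK x : x \in iota 0 K -> x < w by rewrite mem_iota => /andP[_ ?]; rewrite ltn_addr.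
have Kd : K + d < w by rewrite ltn_add2l.
have cols : {in K + d :: iota 0 K, forall i, i < n + w.+1}.
  by move=> x; rewrite inE => /orP[/eqP->|/iK]; apply: low.
have colsn m : m <= w -> {in n + m :: map (addn n) (iota 0 K), forall i, i < n + w.+1}.
  move=> mw x; rewrite inE => /orP[/eqP->|/mapP[y /iK yw ->]]; first exact: lown.
  by apply: lown; apply: ltnW.
apply: fv_below_and.
  apply: fv_below_neq_seq; rewrite ?size_map // => x.
    by move/(free_cols_lt dD)/low.
  by move=> /mapP[y /(free_cols_lt dD)/ltnW yw ->]; apply: lown.
apply: fv_below_or.
  by apply: fv_below_neq_seq; rewrite /= ?size_map //; apply: colsn; apply: ltnW.
apply: fv_below_or; first by apply: fv_below_neq_seq; rewrite /= ?size_map //; apply: colsn.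
by apply: fv_below_eq_var; apply: lown; rewrite // ltnW.
Qed.

Lemma fv_below_fun_eq m i n k y : w < m -> w <= n -> n + k <= m -> i <= D -> y < m ->
  fv_below m (fun_eq tau K D i n k y).
Proof.
move=> wm wn nkm iD ym; apply: fv_below_neq_seq => [|x|x].
- by rewrite /= size_iota size_mkseq.
- rewrite inE mem_iota => /orP[/eqP->|/andP[_ xK]].
    by rewrite (leq_ltn_trans _ wm) // leq_add2l.
  by rewrite (leq_trans _ wm) // ltnW // ltnS ltn_addr.
- by rewrite inE => /orP[/eqP->//|/(args_lt wm wn nkm)/andP[]].
Qed.

Lemma fv_below_tr_term (e : var -> var) ef n t y :
  (forall x, e x < n) -> (forall F, ef F <= D) -> w < n -> y < n ->
  fv_below n (tr_term K D e ef n t y).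
Proof.
elim: t n y => [x|g ts IH] n y en efD wn yn; first exact: fv_below_eq_var.
rewrite [tr_term _ _ _ _ _ _ _]/= -/tr_term; apply: fv_below_exists_block.
have nnk : n <= n + fun_ar g by rewrite leq_addr.
have ink (i : 'I_(fun_ar g)) : n + i < n + fun_ar g by rewrite ltn_add2l.
apply: fv_below_and.
  apply: fv_below_conj => [|i]; first exact: leq_trans (leq_ltn_trans _ wn) nnk.
  by apply: IH => // [x|]; apply: leq_trans nnk.
have ynk : y < n + fun_ar g by apply: leq_trans nnk.
case: g ts IH nnk ink ynk => [g|F] ts IH nnk ink ynk.
  move=> i; rewrite /= inE => /orP[|]; first exact: var_bigcup.
  by rewrite inE => /eqP->.
by apply: fv_below_fun_eq => //; [exact: leq_trans nnk|exact: ltnW].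
Qed.

Lemma fv_below_tr_atom (e : var -> var) er ef n l :
  (forall x, e x < n) -> (forall X, er X <= D) -> (forall F, ef F <= D) -> w < n ->
  fv_below n (@tr_atom tau K D e er ef n l).
Proof.
move=> en erD efD wn; case: l => [R ts|t u]; last first.
  have en' x : e x < n.+1 by rewrite ltnW // ltnS.
  have wn' : w < n.+1 by rewrite ltnW // ltnS.
  by apply: fv_below_ex; apply: fv_below_and; apply: fv_below_tr_term.
apply: fv_below_exists_block.
have nnk : n <= n + rel_ar R by rewrite leq_addr.
have ink (i : 'I_(rel_ar R)) : n + i < n + rel_ar R by rewrite ltn_add2l.
apply: fv_below_and.
  apply: fv_below_conj => [|i]; first exact: leq_trans (leq_ltn_trans _ wn) nnk.
  by apply: fv_below_tr_term => // [x|]; apply: leq_trans nnk.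
case: R ts nnk ink => [R|X] ts nnk ink; first exact: var_bigcup.
by apply: fv_below_fun_eq => //; [exact: leq_trans nnk|exact: ltnW|exact: leq_trans nnk].
Qed.

Lemma fv_below_tr (e : var -> var) er ef d n (phi : so tau) :
  (forall x, e x < n) -> (forall X, er X <= D) -> (forall F, ef F <= D) ->
  w < n -> d + so_depth phi <= D -> fv_below n (tr K D e er ef d n phi).
Proof.
have ext x n' (e' : var -> var) : (forall y, e' y < n') ->
    forall y, [eta e' with x |-> n'] y < n'.+1.
  by move=> en y /=; case: ifP => // _; rewrite ltnW // ltnS.
have ext2 (X : sovar) d' (er' : sovar -> nat) : d' < D -> (forall Y, er' Y <= D) ->
    forall Y, [eta er' with X |-> d'] Y <= D.
  by move=> /ltnW dD H Y /=; case: ifP.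
elim: phi e er ef d n => [l|phi IH|phi IH psi IH'|phi IH psi IH'|x phi IH|x phi IH
    |X phi IH|X phi IH|F phi IH|F phi IH] e er ef d n en erD efD wn /= dD.
- exact: fv_below_tr_atom.
- exact: IH.
- move: dD; rewrite addn_maxr geq_max => /andP[d1 d2].
  by apply: fv_below_and; [apply: IH|apply: IH'].
- move: dD; rewrite addn_maxr geq_max => /andP[d1 d2].
  by apply: fv_below_and; [apply: IH|apply: IH'].
- by apply: fv_below_ex; apply: IH => //; [exact: ext|exact: ltnW].
- by apply: fv_below_all; apply: IH => //; [exact: ext|exact: ltnW].
all: have dD' : d < D by apply: leq_trans dD; rewrite addnS ltnS leq_addr.
all: have gP := fv_below_is_graph dD' (ltnW wn).
all: rewrite -addSnnS in dD.
(* Negations and the choice of binary connective do not affect free variables, so [exists_fun] is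
   treated as a conjunction. *)
- by apply: (fv_below_and gP); apply: IH => //; exact: ext2.
- by apply: (fv_below_and gP); apply: IH => //; exact: ext2.
- by apply: (fv_below_and gP); apply: IH => //; exact: ext2.
- by apply: (fv_below_and gP); apply: IH => //; exact: ext2.
Qed.

End FreeVariables.

(** * One-element structures *)

Section OneElement.
Variable tau : signature.

(** On a one-element structure a relation is just a truth value, while the
    values of terms and of function variables do not matter. *)
Fixpoint tr1 (rho : sovar -> bool) (phi : so tau) : fot tau :=
  match phi with
  | SAtom (Rel (inl R) _) => FAtom (Rel (fun _ : 'I_(rel_ar R) => Var 0))
  | SAtom (Rel (inr X) _) => if rho X then true_fot tau else FNot (true_fot tau)
  | SAtom (Eq _ _) => true_fot tau
  | SNot phi => FNot (tr1 rho phi)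
  | SAnd phi psi => FAnd (tr1 rho phi) (tr1 rho psi)
  | SOr phi psi => FOr (tr1 rho phi) (tr1 rho psi)
  | SEx _ phi | SAll _ phi | SExF _ phi | SAllF _ phi => tr1 rho phi
  | SExR X phi =>
      FOr (tr1 [eta rho with X |-> true] phi) (tr1 [eta rho with X |-> false] phi)
  | SAllR X phi =>
      FAnd (tr1 [eta rho with X |-> true] phi) (tr1 [eta rho with X |-> false] phi)
  end.

Lemma fv_below_tr1 n rho phi : 0 < n -> fv_below n (tr1 rho phi).
Proof.
move=> n0; elim: phi rho => //=; try by move=> *; apply: fv_below_and.
move=> [[R|X] ts|t u] rho; last exact: fv_below_true.
  exact: var_bigcup.
by case: ifP => _; apply: fv_below_true.
Qed.

Lemma term_val_ex (M : structure tau) (s : assignment M) (t : term tau) :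
  {subset term_vars t <= domf s} -> exists a, term_val s t a.
Proof.
elim: t => [x|g ts IH] /= Hs.
  have xs : x \in domf s by apply: Hs; rewrite inE.
  by exists s.[xs]%fmap; rewrite in_fnd.
have /choice[v vE] i : exists a, term_val s (ts i) a.
  apply: IH => x xi; apply: Hs; apply/bigfcupP; exists i => //.
  by rewrite mem_index_enum.
by exists (fun_int v); exists v.
Qed.

End OneElement.

(** The formula contains no quantifier, so the team [T] stays fixed during the induction. In
    second-order logic, individuals and functions have one possible value each, and a relation is
    either empty or full. *)
Lemma tr1P (tau : signature) (M : structure tau) (T : set (assignment M))
    (VR : rel_valuation M) (VF : fun_valuation M) (s : assignment M)
    (rho : sovar -> bool) (phi : so tau) :
  (forall a b : M, a = b) -> T !=set0%classic -> (forall t, T t -> 0 \in domf t) ->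
  {subset so_fv phi <= domf s} ->
  (forall X, X \in so_fv_rel phi -> forall v, VR X v <-> rho X) ->
  fot_sat T (tr1 rho phi) <-> so_sat VR VF s phi.
Proof.
move=> M1 T0 T00; have [a0] := dom_inhabited M.
have notP psi : fot_sat T (FNot psi) <-> ~ fot_sat T psi.
  by split=> [[T0'|//]|]; [case: T0 => t; rewrite T0'|right].
have trueP := true_fot_sat T00.
elim: phi VR VF s rho => [l|phi IH|phi IH psi IH'|phi IH psi IH'|x phi IH|x phi IH
    |X phi IH|X phi IH|F phi IH|F phi IH] VR VF s rho Hs HX.
- case: l Hs HX => [R ts|t u] Hs HX; last first.
    split=> // _.
    have tP (t' : term (so_sig tau)) : {subset term_vars t' <= atom_vars (Eq t u)} ->
        exists a, @term_val (so_sig tau) (so_expand VR VF) s t' a.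
      by move=> sub; apply: term_val_ex => x /sub /Hs.
    have [x xt|a ta] := tP t; first by rewrite inE xt.
    have [x xu|b ub] := tP u; first by rewrite inE xu orbT.
    by exists a; split=> //; rewrite (M1 a b).
  have /choice[v vE] i : exists a, @term_val (so_sig tau) (so_expand VR VF) s (ts i) a.
    apply: term_val_ex => x xi; apply: Hs; apply/bigfcupP; exists i => //.
    by rewrite mem_index_enum.
  (* Any two tuples of values coincide, so the existential over values amounts to the chosen [v]. *)
  have relE : @rel_int (so_sig tau) (so_expand VR VF) R v <->
      @atom_sat (so_sig tau) (so_expand VR VF) s (Rel ts).
    split=> [Rv|[v' [_ Rv']]]; first by exists v.
    by rewrite (_ : v = v') //; apply: funext => i; apply: M1.
  rewrite -[so_sat _ _ _ _]/(@atom_sat (so_sig tau) (so_expand VR VF) s (Rel ts)) -relE.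
  case: R ts v {vE relE Hs} HX => [R|X] ts v HX /=.
    split=> [H|Rv t Tt].
      have [t Tt] := T0; have [v' [_ Rv']] := H t Tt.
      by rewrite (_ : v = v') //; apply: funext => i; apply: M1.
    exists (fun _ => t.[T00 t Tt])%fmap; split=> [i|]; first by rewrite /= (in_fnd (T00 t Tt)).
    by rewrite (_ : (fun _ => _) = v) //; apply: funext => i; apply: M1.
  rewrite HX ?inE //; case: (rho X) => //.
  by rewrite notP; split=> // H; case: (H trueP).
- by rewrite notP (IH VR VF s).
- rewrite /= (IH VR VF s) ?(IH' VR VF s) // => x xp;
    (by first [apply: Hs|apply: HX]; rewrite inE xp ?orbT).
- rewrite /= (IH VR VF s) ?(IH' VR VF s) // => x xp;
    (by first [apply: Hs|apply: HX]; rewrite inE xp ?orbT).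
- have E a : fot_sat T (tr1 rho phi) <-> so_sat VR VF s.[x <- a]%fmap phi.
    apply: IH => // y yp; rewrite dom_setf !inE.
    by case: eqVneq => //= yx; apply: Hs; rewrite !inE yx.
  by split=> [/(E a0)|[a /E]//]; exists a0.
- have E a : fot_sat T (tr1 rho phi) <-> so_sat VR VF s.[x <- a]%fmap phi.
    apply: IH => // y yp; rewrite dom_setf !inE.
    by case: eqVneq => //= yx; apply: Hs; rewrite !inE yx.
  by split=> [H a|H]; [apply/E|apply/(E a0); apply: H].
- have E (R : nrel M X.1) (b : bool) : (forall v, R v <-> b) ->
      fot_sat T (tr1 [eta rho with X |-> b] phi) <-> so_sat (dfwith VR R) VF s phi.
    move=> Rb; apply: IH => // Y Yp v /=.
    case: eqVneq => [YX|YX]; first by move: v; rewrite YX dfwith_in.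
    by rewrite dfwith_out 1?eq_sym // HX // !inE YX.
  split=> [[] H|[R HR]].
  + by exists (fun _ => True); apply: (iffLR (E _ true _)) H.
  + by exists (fun _ => False); apply: (iffLR (E _ false _)) H.
  (* There is only one tuple, so [R] is constant and its truth value selects the disjunct. *)
  have Rb v : R v <-> `[< R (fun _ => a0) >].
    rewrite (_ : v = (fun _ => a0)); last by apply: funext => i; apply: M1.
    by split=> /asboolP.
  move: Rb HR; case: asbool => /E HR /HR; [by left|by right].
- have E (R : nrel M X.1) (b : bool) : (forall v, R v <-> b) ->
      fot_sat T (tr1 [eta rho with X |-> b] phi) <-> so_sat (dfwith VR R) VF s phi.
    move=> Rb; apply: IH => // Y Yp v /=.
    case: eqVneq => [YX|YX]; first by move: v; rewrite YX dfwith_in.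
    by rewrite dfwith_out 1?eq_sym // HX // !inE YX.
  split=> [[Ht Hf] R|H].
    have Rb v : R v <-> `[< R (fun _ => a0) >].
      rewrite (_ : v = (fun _ => a0)); last by apply: funext => i; apply: M1.
      by split=> /asboolP.
    by move: Rb; case: asbool => /E RE; apply/RE.
  split; first by apply/(E (fun _ => True)).
  by apply/(E (fun _ => False)).
- have E (g : nfun M F.1) : fot_sat T (tr1 rho phi) <-> so_sat VR (dfwith VF g) s phi.
    exact: IH.
  by split=> [/(E (fun _ => a0))|[g /E]//]; exists (fun _ => a0).
- have E (g : nfun M F.1) : fot_sat T (tr1 rho phi) <-> so_sat VR (dfwith VF g) s phi.
    exact: IH.
  by split=> [H g|H]; [apply/E|apply/(E (fun _ => a0)); apply: H].
Qed.

(** * The full team and the final formula *)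

Lemma full_teamE (tau : signature) (M : structure tau) w (c : nat -> M) :
  @full_team M (iota 0 w) = team_of w setT w c.
Proof.
have [a0] := dom_inhabited M.
have lookup (g : nat -> M) : forall i, i < w -> glue w c g i = g i.
  by move=> i iw; rewrite /glue iw.
apply/seteqP; split=> s.
  (* The default [a0] is taken only outside the domain of [s], that is, from [w] on. *)
  move=> sw; exists (fun i => odflt a0 s.[? i]%fmap) => //.
  apply/fmapP => i; rewrite initial_assignmentE.
  have iE : (i \in domf s) = (i < w) by rewrite sw inE mem_iota.
  rewrite -iE; case: fndP => // i_s.
  by rewrite lookup -?iE // in_fnd.
move=> [g _ <-]; apply/fsetP => i.
by rewrite inE mem_iota -fndSome initial_assignmentE add0n /=; case: ifP.
Qed.

Theorem theorem4p4 (tau : signature) (Phi : so tau) (hPhi : so_sentence Phi) :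
  exists (r : seq var) (Phio : fot tau),
    [/\ uniq r,
        (fot_fv Phio `<=` [fset x in r])%fset,
        fot_fv Phio <> fset0 &
        forall M : structure tau,
          so_models M Phi <-> fot_sat (@full_team M r) Phio].
Proof.
case: hPhi => fv0 fvr0 fvf0.
(* The successor guarantees [0 < w], so that the variable 0 is always a column. *)
pose K := (so_arity Phi).+1; pose D := so_depth Phi; pose w := K + D.
(* With [w] bound outside, this says that the structure has one element, and [body] distinguishes
   the two cases accordingly. *)
pose single : fot tau := FAll w.+1 (FAtom (Eq (Var w) (Var w.+1))).
pose small := tr1 (fun=> false) Phi.
(* As [Phi] has no free variables, any initial location among the constants will do, and [w] is the
   only constant so far. *)
pose large := tr K D (fun=> w) (fun=> 0) (fun=> 0) 0 w.+1 Phi.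
pose body := FOr (FAnd single small) (FAnd (FNot single) large).
have w0 : 0 < w by [].
(* The first conjunct makes the variable 0 occur free; the quantifier over [w] provides the base
   point. *)
exists (iota 0 w), (FAnd (true_fot tau) (FEx w body)); split.
- exact: iota_uniq.
- have : fv_below w (FAnd (true_fot tau) (FEx w body)).
    apply: fv_below_and; first exact: fv_below_true.
    have singleP : fv_below w.+1 single.
      by apply: fv_below_all; apply: fv_below_eq_var.
    apply: fv_below_ex; apply: fv_below_or; apply: fv_below_and => //.
      exact: fv_below_tr1.
    by apply: fv_below_tr => //= [x]; rewrite /w ?leq_addr.
  by move=> H; apply/fsubsetP => i /H iw; rewrite in_fset mem_iota.
- by move/fsetP/(_ 0); rewrite /= !inE.
move=> M; have [a0] := dom_inhabited M.
pose f0 (_ : nat) (_ : seq M) := a0.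
(* The equivalence holds for every base point and all valuations, so the existential choice of [w]
   cannot influence the outcome. *)
have E a (VR : rel_valuation M) (VF : fun_valuation M) :
    holds w setT w.+1 [eta (fun=> a0) with w |-> a] body <-> so_sat VR VF [fmap]%fmap Phi.
  pose c := [eta (fun=> a0) with w |-> a].
  (* With no function stored yet, the team of graphs is the full one. *)
  have gT : setT = graphs K 0 f0 by apply/seteqP; split.
  have g0 : (setT : set (nat -> M)) !=set0%classic by exists (fun=> a0).
  have singleP : holds w setT w.+1 c single <-> forall b, b = a.
    have cE b : holds w setT w.+2 [eta c with w.+1 |-> b]
        (FAtom (Eq (Var w) (Var w.+1))) <-> a = b.
      rewrite holds_eq_var ?leqnn ?leqnSn //.
      by rewrite /c /= ltn_eqF // !eqxx.
    by rewrite holds_all //; split=> H b; [apply/esym/cE|apply/cE/esym].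
  have [M1|M2] := pselect (forall b, b = a).
    have tP : holds w setT w.+1 c small <-> so_sat VR VF [fmap]%fmap Phi.
      apply: tr1P => [b b'||t [g _ <-]|x|X].
      - by rewrite (M1 b) (M1 b').
      - by apply/set0P/eqP => /team_of_eq0 T0; case: g0 => g; rewrite T0.
      - by rewrite -fndSome initial_assignmentE.
      - by rewrite fv0.
      - by rewrite fvr0.
    have nsingle : ~ holds w setT w.+1 c (FNot single).
      by rewrite holds_not // => ns; apply: ns; apply/singleP.
    split=> [[[_ /tP//]|[/nsingle//]]|/tP H].
    by left; split=> //; apply/singleP.
  have tP : holds w setT w.+1 c large <-> so_sat VR VF [fmap]%fmap Phi.
    rewrite gT; apply: trP => //.
    - by move=> x; rewrite -/w !leqnn.
    - have /existsNP[b ba] := M2; exists b; rewrite /c /= -/w eqxx; exact: ba.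
    - by rewrite fv0.
    - by rewrite fvr0.
    - by rewrite fvf0.
  split=> [[[/singleP//]|[_ /tP//]]|/tP H].
  by right; split=> //; rewrite -/(holds _ _ _ _ _) holds_not // => /singleP.
have exE : holds w setT w (fun=> a0) (FEx w body) <->
    exists a, holds w setT w.+1 [eta (fun=> a0) with w |-> a] body by apply: holds_ex.
rewrite (full_teamE w (fun=> a0)); split.
  (* Truth under one concrete pair of valuations suffices here; the formula mentions no valuation,
     so the converse reaches all of them. *)
  move=> H; split; first exact: holds_true.
  by apply/exE; exists a0; apply/(E a0 (fun _ _ => True) (fun _ _ => a0)).
by move=> [_ /exE[a H]] VR VF; apply/(E a).
Qed.
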